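(* A subshift $X\subset\Sigma^{\mathbb Z}$ that satisfies the conditions (H01)–(H11) listed in the context is not synchronizing.
   Context: **Basic notation.** $\Sigma$ is a finite alphabet, $S$ the left shift, $(Sx)_i=x_{i+1}$; a subshift $X\subset\Sigma^{\mathbb Z}$ is a closed shift-invariant set, $\mathcal O(X)$ its set of $S$-orbits, $\mathcal L(X)$ its language of admissible words. For an interval $I$, $x_I$ is the restriction of $x$ to $I$ and $X_I=\{x_I:x\in X\}$. A topologically transitive subshift $X$ is called synchronizing if there is a word $b\in\mathcal L(X)$ such that $ab\in\mathcal L(X)$ and $bc\in\mathcal L(X)$ imply $abc\in\mathcal L(X)$ for all words $a,c$. For a block $a\in X_{[i,j]}$: $\Gamma^{\langle+\rangle}(a)=\{u\in X_{(j,\infty)}: au\in X_{[i,\infty)}\}$, $\Gamma^{\langle-\rangle}(a)=\{v\in X_{(-\infty,i)}: va\in X_{(-\infty,j]}\}$, $\omega^{\langle+\rangle}(a)=\{u\in\Gamma^{\langle+\rangle}(a): vau\in X\ \forall v\in\Gamma^{\langle-\rangle}(a)\}$, $\omega^{\langle-\rangle}(a)=\{v\in\Gamma^{\langle-\rangle}(a): vau\in X\ \forall u\in\Gamma^{\langle+\rangle}(a)\}$. **Neutral points.** $A^{(-)}(X)$ is the set of $x\in X$ such that for all $i\in\mathbb Z$ there is $j\in\mathbb N$ with $x_{[i,\infty)}\in\omega^{\langle+\rangle}(x_{[i-j,i)})$; $A^{(+)}(X)$ is the set of $x\in X$ such that for all $i$ there is $j\in\mathbb N$ with $x_{(-\infty,i]}\in\omega^{\langle-\rangle}(x_{(i,i+j]})$.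 $A^0(X)=A^{(-)}(X)\cap A^{(+)}(X)$, $A^{-}(X)=A^{(-)}(X)\setminus A^0(X)$, $A^+(X)=A^{(+)}(X)\setminus A^0(X)$. $\mathcal O^0(X)$ is the set of orbits of periodic points contained in $A^0(X)$ (neutral periodic orbits). **Asymptotic orbits.** A point $x$ is left (right) asymptotic to a periodic point $p$ if $x_i=p_i$ for all sufficiently small (large) $i$; an orbit is left (right) asymptotic to a periodic orbit $\mathfrak p$ if some point of it is left (right) asymptotic to some point of $\mathfrak p$. $\mathcal F(\mathfrak p,\bullet)$ (resp. $\mathcal F(\bullet,\mathfrak p)$) is the set of orbits in $\mathcal O(X)\setminus\{\mathfrak p\}$ left (resp. right) asymptotic to $\mathfrak p\in\mathcal O^0(X)$; $\mathcal F(\mathfrak q,\mathfrak r)=\mathcal F(\mathfrak q,\bullet)\cap\mathcal F(\bullet,\mathfrak r)$; $\mathcal F(X)=\bigcup_{\mathfrak q,\mathfrak r\in\mathcal O^0(X)}\mathcal F(\mathfrak q,\mathfrak r)$; for $\epsilon\in\{-,0,+\}$, $\mathcal F^\epsilon(\mathfrak q,\mathfrak r)$ is the set of orbits in $\mathcal F(\mathfrak q,\mathfrak r)$ contained in $A^\epsilon(X)$. For a nonperiodic point $x$ right asymptotic to a periodic orbit $\mathfrak p$, $I^+(x)=\min\{i: x_j=x_{j+\mathrm{card}(\mathfrak p)}\ \forall j\ge i\}$; for a nonperiodic $x$ left asymptotic to $\mathfrak p$, $I^-(x)=\max\{i: x_j=x_{j-\mathrm{card}(\mathfrak p)}\ \forall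 j\le i\}$. **Concatenation.** Let $\mathfrak p\in\mathcal O^0(X)$ and let $\mathfrak x^{-}$, $\mathfrak x^{+}$ be shift orbits in $\Sigma^{\mathbb Z}$, different from $\mathfrak p$, right, resp. left, asymptotic to $\mathfrak p$. Choose $x^-\in\mathfrak x^-$, $x^+\in\mathfrak x^+$ with $I^+(x^-)=0=I^-(x^+)$, let $p^-,p^+\in\mathfrak p$ be such that $x^-$ is right asymptotic to $p^-$ and $x^+$ is left asymptotic to $p^+$, and let $0\le D<\mathrm{card}(\mathfrak p)$ with $S^Dp^-=p^+$. For $m\in\mathbb N$, $\mathrm{cnc}_m\langle\mathfrak x^-,\mathfrak x^+\rangle$ is the shift orbit of the point $z$ with $z_{(-\infty,0)}=x^-_{(-\infty,0)}$, $z_{[0,m\,\mathrm{card}(\mathfrak p)+D]}=p^-_{[0,m\,\mathrm{card}(\mathfrak p)+D]}$, and $z_{(m\,\mathrm{card}(\mathfrak p)+D,\infty)}=x^+_{(0,\infty)}$. (H01) For $\mathfrak q,\mathfrak r\in\mathcal O^0(X)$, $\mathcal F^-(\mathfrak q,\mathfrak r)$ and $\mathcal F^+(\mathfrak q,\mathfrak r)$ are not empty. (H02) For $\mathfrak p\in\mathcal O^0(X)$, $\mathcal F^0(\mathfrak p,\mathfrak p)\ne\emptyset$. (H03) There is $M\in\mathbb N$ such that for all $m>M$, $\mathfrak p\in\mathcal O^0(X)$, $\mathfrak x^-\in\mathcal F(\bullet,\mathfrak p)$, $\mathfrak x^+\in\mathcal F(\mathfrak p,\bullet)$: $\mathrm{cnc}_m\langle\mathfrak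 x^-,\mathfrak x^+\rangle\in\mathcal O(X)$ iff $\mathrm{cnc}_M\langle\mathfrak x^-,\mathfrak x^+\rangle\in\mathcal O(X)$. For $\mathfrak x^{(k)}\in\mathcal F(\mathfrak p^{(k-1)},\mathfrak p^{(k)})$, $1\le k\le K$ (the first may be in $\mathcal F(\bullet,\mathfrak p^{(1)})$, the last in $\mathcal F(\mathfrak p^{(K-1)},\bullet)$), $\mathrm{cnc}\langle\mathfrak x^{(1)},\dots,\mathfrak x^{(K)}\rangle$ denotes the iterated concatenation with parameters $m_k\ge M$, which are suppressed in the notation (any fixed choice may be used). (H04) For $\mathfrak q\ne\mathfrak r$ in $\mathcal O^0(X)$: $\mathcal F^0(\mathfrak q,\mathfrak r)\neq\emptyset$ iff $\mathcal F^0(\mathfrak r,\mathfrak q)\ne\emptyset$. Write $\mathfrak q\sim\mathfrak r$ if $\mathcal F^0(\mathfrak q,\mathfrak r)\ne\emptyset$ (an equivalence relation); $\mathfrak V(X)$ is the set of $\sim$-classes. (H05) $\mathfrak V(X)$ is finite. (H06) For $V\in\mathfrak V(X)$, $\bigcup_{\mathfrak p\in V}\mathfrak p$ is dense in $X$. (H07) For $V\in\mathfrak V(X)$, $\mathfrak q,\mathfrak r\in V$, $\mathfrak x\in\mathcal F(\bullet,\mathfrak q)$, $\mathfrak y\in\mathcal F(\mathfrak r,\bullet)$, $\mathfrak u,\mathfrak v\in\mathcal F^0(\mathfrak q,\mathfrak r)$: $\mathrm{cnc}\langle\mathfrak x,\mathfrak u,\mathfrak y\rangle\in\mathcal O(X)$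 iff $\mathrm{cnc}\langle\mathfrak x,\mathfrak v,\mathfrak y\rangle\in\mathcal O(X)$. **The semigroup $\mathcal S(X)$.** For $\mathfrak x\in\mathcal F(\mathfrak q,\mathfrak r)$, $\tilde{\mathfrak x}\in\mathcal F(\tilde{\mathfrak q},\tilde{\mathfrak r})$: $\mathfrak x\approx\tilde{\mathfrak x}$ if $\mathfrak q=\tilde{\mathfrak q}$, $\mathfrak r=\tilde{\mathfrak r}$ and for all $\mathfrak u\in\mathcal F(\bullet,\mathfrak q)$, $\mathfrak v\in\mathcal F(\mathfrak r,\bullet)$: $\mathrm{cnc}\langle\mathfrak u,\mathfrak x,\mathfrak v\rangle\in\mathcal O(X)$ iff $\mathrm{cnc}\langle\mathfrak u,\tilde{\mathfrak x},\mathfrak v\rangle\in\mathcal O(X)$. And $\mathfrak x\cong\tilde{\mathfrak x}$ if $\mathfrak q\sim\tilde{\mathfrak q}$, $\mathfrak r\sim\tilde{\mathfrak r}$ and for all $\hat{\mathfrak q}\sim\mathfrak q$, $\hat{\mathfrak r}\sim\mathfrak r$, $\mathfrak u\in\mathcal F^0(\hat{\mathfrak q},\mathfrak q)$, $\tilde{\mathfrak u}\in\mathcal F^0(\hat{\mathfrak q},\tilde{\mathfrak q})$, $\mathfrak v\in\mathcal F^0(\mathfrak r,\hat{\mathfrak r})$, $\tilde{\mathfrak v}\in\mathcal F^0(\tilde{\mathfrak r},\hat{\mathfrak r})$: $\mathrm{cnc}\langle\mathfrak u,\mathfrak x,\mathfrak v\rangle\approx\mathrm{cnc}\langle\tilde{\mathfrak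 u},\tilde{\mathfrak x},\tilde{\mathfrak v}\rangle$. $\mathcal S(X)$ is the set of $\cong$-classes together with a zero. The product of the classes of $\mathfrak x^-\in\mathcal F(\mathfrak q^-,\mathfrak r^-)$ and $\mathfrak x^+\in\mathcal F(\mathfrak q^+,\mathfrak r^+)$ is $0$ if $\mathfrak r^-\not\sim\mathfrak q^+$; otherwise one chooses $\mathfrak p\sim\mathfrak r^-$, $\mathfrak u^-\in\mathcal F^0(\mathfrak r^-,\mathfrak p)$, $\mathfrak u^+\in\mathcal F^0(\mathfrak p,\mathfrak q^+)$ and the product is the class of $\mathrm{cnc}\langle\mathfrak x^-,\mathfrak u^-,\mathfrak u^+,\mathfrak x^+\rangle$ if this orbit is in $\mathcal O(X)$, and $0$ otherwise (this is well defined and associative). For $V\in\mathfrak V(X)$, $\mathbf 1_V$ is the common class of all orbits in $\mathcal F^0(\mathfrak q,\mathfrak r)$, $\mathfrak q,\mathfrak r\in V$ (the local units). $\mathcal S^-(X)$ is the set of nonzero $f$, not local units, such that, for $V$ with $f=\mathbf 1_Vf$, $gf\neq0$ for all $g\neq0$ with $g=g\mathbf 1_V$; $\mathcal S^+(X)$ is the set of nonzero $f$, not local units, such that, for $V$ with $f=f\mathbf 1_V$, $fg\ne0$ for all $g\ne0$ with $g=\mathbf 1_Vg$. $\mathcal E^\pm(X)$ is the set of elements of $\mathcal S^\pm(X)$ that are not products of two elements of $\mathcal S^\pm(X)$. $\mathcal E^-(U,W)=\mathbf 1_U\mathcal E^-(X)\mathbf 1_W$ ($\setminus\{0\}$), regarded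 as edges with source $U$ and target $W$; $\mathcal E^+(U,W)=\mathbf 1_W\mathcal E^+(X)\mathbf 1_U$ ($\setminus\{0\}$), regarded as edges with source $W$ and target $U$. (H08) For $U,W\in\mathfrak V(X)$: for each $e^-\in\mathcal E^-(U,W)$ there is $e^+\in\mathcal E^+(U,W)$ with $e^-e^+=\mathbf 1_U$, and for each $e^+\in\mathcal E^+(U,W)$ there is $e^-\in\mathcal E^-(U,W)$ with $e^-e^+=\mathbf 1_U$. (H09) Every $f^-\in\mathcal S^-(X)$ with $f^-=\mathbf 1_Uf^-\mathbf 1_W$ is in a unique way a product $e_1^-e_2^-\cdots e_K^-$, $K\in\mathbb N$, $e_k^-\in\mathcal E^-(V_{k-1},V_k)$, $V_0=U$, $V_K=W$; every $f^+\in\mathcal S^+(X)$ with $f^+=\mathbf 1_Wf^+\mathbf 1_U$ is in a unique way a product $e_K^+\cdots e_1^+$, $e_k^+\in\mathcal E^+(V_{k-1},V_k)$, $V_0=U$, $V_K=W$. (H10) The nonzero elements of $\mathcal S(X)\setminus(\mathcal S^-(X)\cup\mathcal S^+(X))$ are exactly the $\mathbf 1_V$, $V\in\mathfrak V(X)$, and the nonzero elements of $\mathcal S^+(X)\mathbf 1_V\mathcal S^-(X)$, $V\in\mathfrak V(X)$. (H11) The directed graph with vertex set $\mathfrak V(X)$ and edge set $\mathcal E^-(X)$ is not a cycle, and the directed graph with vertex set $\mathfrak V(X)$ and edge set $\mathcal E^+(X)$ is not a cycle. (A cycle is a directed graph with vertices $V_0,\dots,V_{n-1}$, $n\ge1$,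 and exactly $n$ edges, one from $V_k$ to $V_{k+1\bmod n}$ for each $k$.) *)

(* Defs.v *)
From HB Require Import structures.
From mathcomp Require Import all_boot all_order all_algebra finmap.
From mathcomp Require Import boolp classical_sets functions cardinality topology.

Set Implicit Arguments.
Unset Strict Implicit.
Unset Printing Implicit Defensive.
Import Order.TTheory GRing.Theory Num.Theory.

Local Open Scope classical_set_scope.
Local Open Scope ring_scope.

Definition config (Sigma : finType) : Type := int -> Sigma.

Definition orbit_t (Sigma : finType) : Type := set (config Sigma).

(* Sigma^Z with the product of the discrete topologies. *)
Notation fullshift Sigma := {ptws int -> discrete_topology Sigma}.

Section Points.
Variable Sigma : finType.
Implicit Types (X : set (config Sigma)) (x y u v a : config Sigma).

(* shiftz n is the n-th power of the left shift S = shiftz 1, for n in Z. *)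
Definition shiftz (n : int) x : config Sigma := fun i => x (i + n).

Definition subshift X : Prop :=
  closed (X : set (fullshift Sigma)) /\ shiftz 1 @` X = X.

Definition orbit x : orbit_t Sigma := [set y | exists n : int, y = shiftz n x].

Definition orbits X : set (orbit_t Sigma) := [set orbit x | x in X].

Definition language X : set (seq Sigma) :=
  [set w | exists x i, X x /\ w = [seq x (i + k%:Z) | k <- iota 0 (size w)]].

Definition topologically_transitive X : Prop :=
  forall U V : set (fullshift Sigma), open U -> open V ->
    U `&` X !=set0 -> V `&` X !=set0 ->
    exists n : nat, (shiftz n%:Z @` (U `&` X)) `&` V !=set0.

Definition synchronizing X : Prop :=
  topologically_transitive X /\
  exists2 b, language X b &
    forall a c : seq Sigma, language X (a ++ b) -> language X (b ++ c) ->
      language X (a ++ b ++ c).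

(* A block on [i, j] is given by a point a, of which only the restriction to
   [i, j] matters.  Similarly a right-infinite u on (j, oo) and a left-infinite
   v on (-oo, i) are given by points of which only these restrictions matter. *)
Definition glue (i j : int) v a u : config Sigma :=
  fun k => if k < i then v k else if k <= j then a k else u k.

Definition Gamma_plus X (i j : int) a : set (config Sigma) :=
  [set u | exists2 y, X y & {in `[i, j], y =1 a} /\ {in `]j, +oo[, y =1 u}].

Definition Gamma_minus X (i j : int) a : set (config Sigma) :=
  [set v | exists2 y, X y & {in `]-oo, i[, y =1 v} /\ {in `[i, j], y =1 a}].

Definition omega_plus X (i j : int) a : set (config Sigma) :=
  [set u | Gamma_plus X i j a u /\
           forall v, Gamma_minus X i j a v -> X (glue i j v a u)].

Definition omega_minus X (i j : int) a : set (config Sigma) :=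
  [set v | Gamma_minus X i j a v /\
           forall u, Gamma_plus X i j a u -> X (glue i j v a u)].

Definition Aleft X : set (config Sigma) :=
  [set x | X x /\
     forall i : int, exists j : nat, omega_plus X (i - j%:Z) (i - 1) x x].

Definition Aright X : set (config Sigma) :=
  [set x | X x /\
     forall i : int, exists j : nat, omega_minus X (i + 1) (i + j%:Z) x x].

Definition Azero X := Aleft X `&` Aright X.
Definition Aminus X := Aleft X `\` Azero X.
Definition Aplus X := Aright X `\` Azero X.

Definition periodic x : Prop := exists2 n : nat, (0 < n)%N & shiftz n%:Z x = x.

Definition left_asymptotic x y : Prop :=
  exists N : int, forall i, i <= N -> x i = y i.

Definition right_asymptotic x y : Prop :=
  exists N : int, forall i, N <= i -> x i = y i.

Definition is_Iplus (n : nat) x (i : int) : Prop :=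
  (forall j, i <= j -> x j = x (j + n%:Z)) /\
  (forall i', (forall j, i' <= j -> x j = x (j + n%:Z)) -> i <= i').

Definition is_Iminus (n : nat) x (i : int) : Prop :=
  (forall j, j <= i -> x j = x (j - n%:Z)) /\
  (forall i', (forall j, j <= i' -> x j = x (j - n%:Z)) -> i' <= i).

(* x_(-oo,0) followed by p_[0,L] followed by y_(0,oo), the last starting at
   coordinate L + 1. *)
Definition cnc_point (L : int) x (p : config Sigma) y : config Sigma :=
  fun i => if i < 0 then x i else if i <= L then p i else y (i - L).

End Points.

Section Orbits.
Variable Sigma : finType.
Implicit Types (X : set (config Sigma)) (p q r x y u v xm xp : orbit_t Sigma).
Implicit Types (U V W : set (orbit_t Sigma)).

Definition neutral X : set (orbit_t Sigma) :=
  [set p | orbits X p /\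
     exists x : config Sigma, [/\ periodic x, p = orbit x & p `<=` Azero X]].

Definition Fleft X (p : orbit_t Sigma) : set (orbit_t Sigma) :=
  [set x | [/\ orbits X x, x <> p &
               exists a b : config Sigma, [/\ x a, p b & left_asymptotic a b]]].

Definition Fright X (p : orbit_t Sigma) : set (orbit_t Sigma) :=
  [set x | [/\ orbits X x, x <> p &
               exists a b : config Sigma, [/\ x a, p b & right_asymptotic a b]]].

Definition F X (q r : orbit_t Sigma) := Fleft X q `&` Fright X r.

Definition Fall X : set (orbit_t Sigma) :=
  \bigcup_(q in neutral X) \bigcup_(r in neutral X) F X q r.

Definition Fzero X q r := F X q r `&` [set x | x `<=` Azero X].
Definition Fminus X q r := F X q r `&` [set x | x `<=` Aminus X].
Definition Fplus X q r := F X q r `&` [set x | x `<=` Aplus X].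

Definition card_orbit (p : orbit_t Sigma) : nat := #|` fset_set p|.

(* The orbit cnc_m<xm, xp>.  The neutral periodic orbit p at which the orbits
   are joined is determined by xm and xp, and so is the point built from them;
   cnc is the empty set, hence not an orbit, when there is nothing to join. *)
Definition cnc_at X (m : nat) (xm xp : orbit_t Sigma) : orbit_t Sigma :=
  [set z | exists p (x y px py : config Sigma) (D : nat),
     [/\ [/\ neutral X p, xm <> p & xp <> p],
         [/\ xm = orbit x, p px, right_asymptotic x px &
             is_Iplus (card_orbit p) x 0],
         [/\ xp = orbit y, p py, left_asymptotic y py &
             is_Iminus (card_orbit p) y 0],
         (D < card_orbit p)%N /\ shiftz D%:Z px = py &
         orbit (cnc_point (m * card_orbit p + D)%N%:Z x px y) z]].

Definition nsim X (q r : orbit_t Sigma) : Prop :=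
  [/\ neutral X q, neutral X r & Fzero X q r !=set0].

Definition Vset X : set (set (orbit_t Sigma)) :=
  [set [set r | nsim X q r] | q in neutral X].

Definition H01 X : Prop := forall q r, neutral X q -> neutral X r ->
  Fminus X q r !=set0 /\ Fplus X q r !=set0.

Definition H02 X : Prop := forall p, neutral X p -> Fzero X p p !=set0.

Definition H03 X (M : nat) : Prop :=
  forall m : nat, (M < m)%N -> forall p xm xp,
    neutral X p -> Fright X p xm -> Fleft X p xp ->
    (orbits X (cnc_at X m xm xp) <-> orbits X (cnc_at X M xm xp)).

Definition H04 X : Prop :=
  forall q r, neutral X q -> neutral X r -> q <> r ->
    (Fzero X q r !=set0 <-> Fzero X r q !=set0).

Definition H05 X : Prop := finite_set (Vset X).

Definition H06 X : Prop := forall V, Vset X V ->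
  X `<=` closure (\bigcup_(p in V) p : set (fullshift Sigma)).

(* mu fixes the exponents suppressed in iterated concatenations: the exponent
   used to join xm and xp is mu xm xp.  It may depend on the orbits because for
   a constant exponent the concatenation of two non-periodic orbits can happen
   to be periodic, and then could not be continued. *)
Definition exponents : Type := orbit_t Sigma -> orbit_t Sigma -> nat.

Definition cnc X (mu : exponents) (xm xp : orbit_t Sigma) : orbit_t Sigma :=
  cnc_at X (mu xm xp) xm xp.

(* cncs X mu x [:: y; ..; z] is cnc<x, y, .., z>. *)
Definition cncs X mu (x : orbit_t Sigma) (s : seq (orbit_t Sigma)) :=
  foldl (cnc X mu) x s.

Definition H07 X mu : Prop :=
  forall V, Vset X V -> forall q r, V q -> V r ->
  forall x y u v, Fright X q x -> Fleft X r y -> Fzero X q r u ->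
    Fzero X q r v ->
    (orbits X (cncs X mu x [:: u; y]) <-> orbits X (cncs X mu x [:: v; y])).

Definition approx X mu (x x' : orbit_t Sigma) : Prop :=
  exists q r, [/\ neutral X q, neutral X r, F X q r x, F X q r x' &
    forall u v, Fright X q u -> Fleft X r v ->
      (orbits X (cncs X mu u [:: x; v]) <->
       orbits X (cncs X mu u [:: x'; v]))].

Definition cong X mu (x x' : orbit_t Sigma) : Prop :=
  exists q r q' r',
    [/\ F X q r x, F X q' r' x', nsim X q q', nsim X r r' &
      forall qh rh u u' v v', nsim X qh q -> nsim X rh r ->
        Fzero X qh q u -> Fzero X qh q' u' ->
        Fzero X r rh v -> Fzero X r' rh v' ->
        approx X mu (cncs X mu u [:: x; v]) (cncs X mu u' [:: x'; v'])].

(* The ambient type of S(X): None is the zero, Some c the congruence class c. *)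
Definition selt : Type := option (set (orbit_t Sigma)).

Definition cong_class X mu (x : orbit_t Sigma) : selt :=
  Some [set y | cong X mu x y].

Definition Scar X mu : set selt := None |` [set cong_class X mu x | x in Fall X].

Definition is_smul X mu (f g h : selt) : Prop :=
  exists xm xp qm rm qp rp,
    [/\ [/\ neutral X qm, neutral X rm, neutral X qp & neutral X rp],
        F X qm rm xm /\ f = cong_class X mu xm,
        F X qp rp xp /\ g = cong_class X mu xp &
        (~ nsim X rm qp /\ h = None) \/
        (exists p um up, let y := cncs X mu xm [:: um; up; xp] in
           [/\ nsim X rm qp, nsim X p rm, Fzero X rm p um, Fzero X p qp up &
               h = if `[< orbits X y >] then cong_class X mu y else None])].

(* The result of some choice of representatives and of p, um, up; None when f
   or g is zero. *)
Definition smul X mu (f g : selt) : selt :=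
  xget None [set h | is_smul X mu f g h].

Definition lunit X mu (V : set (orbit_t Sigma)) : selt :=
  xget None [set f | exists q r x,
    [/\ V q, V r, Fzero X q r x & f = cong_class X mu x]].

Definition Sminus X mu : set selt :=
  [set f | [/\ Scar X mu f, f <> None,
     (forall V, Vset X V -> f <> lunit X mu V) &
     (forall V, Vset X V -> f = smul X mu (lunit X mu V) f ->
        forall g, Scar X mu g -> g <> None -> g = smul X mu g (lunit X mu V) ->
          smul X mu g f <> None)]].

Definition Splus X mu : set selt :=
  [set f | [/\ Scar X mu f, f <> None,
     (forall V, Vset X V -> f <> lunit X mu V) &
     (forall V, Vset X V -> f = smul X mu f (lunit X mu V) ->
        forall g, Scar X mu g -> g <> None -> g = smul X mu (lunit X mu V) g ->
          smul X mu f g <> None)]].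

Definition Eminus X mu : set selt :=
  Sminus X mu `\` [set smul X mu f g | f in Sminus X mu & g in Sminus X mu].

Definition Eplus X mu : set selt :=
  Splus X mu `\` [set smul X mu f g | f in Splus X mu & g in Splus X mu].

Definition sandwich X mu (e f g : selt) : selt := smul X mu (smul X mu e f) g.

Definition EminusUW X mu (U W : set (orbit_t Sigma)) : set selt :=
  [set sandwich X mu (lunit X mu U) e (lunit X mu W) | e in Eminus X mu]
    `\ None.

Definition EplusUW X mu (U W : set (orbit_t Sigma)) : set selt :=
  [set sandwich X mu (lunit X mu W) e (lunit X mu U) | e in Eplus X mu]
    `\ None.

Definition H08 X mu : Prop := forall U W, Vset X U -> Vset X W ->
  (forall em, EminusUW X mu U W em ->
     exists2 ep, EplusUW X mu U W ep & smul X mu em ep = lunit X mu U) /\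
  (forall ep, EplusUW X mu U W ep ->
     exists2 em, EminusUW X mu U W em & smul X mu em ep = lunit X mu U).

(* Product of a nonempty list, in the order of the list. *)
Definition smul_seq X mu (s : seq selt) : selt :=
  if s is e :: s' then foldl (smul X mu) e s' else None.

(* s = [:: e_1; ..; e_K] with e_k in E V_(k-1) V_k, V_0 = U and V_K = W. *)
Fixpoint walk X (E : set (orbit_t Sigma) -> set (orbit_t Sigma) -> set selt)
    (U : set (orbit_t Sigma)) (s : seq selt) (W : set (orbit_t Sigma)) : Prop :=
  if s is e :: s' then exists V, [/\ Vset X V, E U V e & walk X E V s' W]
  else U = W.

Definition H09 X mu : Prop := forall U W, Vset X U -> Vset X W ->
  (forall f, Sminus X mu f ->
     f = sandwich X mu (lunit X mu U) f (lunit X mu W) ->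
     exists! s : seq selt, [/\ s <> [::], walk X (EminusUW X mu) U s W &
                               f = smul_seq X mu s]) /\
  (forall f, Splus X mu f ->
     f = sandwich X mu (lunit X mu W) f (lunit X mu U) ->
     exists! s : seq selt, [/\ s <> [::], walk X (EplusUW X mu) U s W &
                               f = smul_seq X mu (rev s)]).

Definition H10 X mu : Prop :=
  (Scar X mu `\` (Sminus X mu `|` Splus X mu)) `\ None =
  [set lunit X mu V | V in Vset X] `|`
  ((\bigcup_(V in Vset X)
     [set sandwich X mu f (lunit X mu V) g | f in Splus X mu & g in Sminus X mu])
    `\ None).

End Orbits.

(* The directed graph with vertex set V and edge set E, inc u v being the set of
   edges with source u and target v, is a cycle (of length n + 1). *)
Definition is_cycle (T I : Type) (V : set T) (E : set I) (inc : T -> T -> set I)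
    : Prop :=
  exists (n : nat) (v : 'I_n.+1 -> T) (e : 'I_n.+1 -> I),
    [/\ injective v, range v = V, injective e, range e = E &
        forall k, inc (v k) (v (ordS k)) (e k)].

Definition H11 (Sigma : finType) (X : set (config Sigma)) mu : Prop :=
  ~ is_cycle (Vset X) (Eminus X mu) (EminusUW X mu) /\
  ~ is_cycle (Vset X) (Eplus X mu) (fun W U => EplusUW X mu U W).

(* Main.v *)
Require Import Defs.
From mathcomp Require Import all_boot all_order all_algebra.
From mathcomp Require Import boolp classical_sets.
From mathcomp Require Import topology zify.

(** In a synchronizing subshift, (H01) fails for the pair (p, p), where p is a
    suitable neutral periodic orbit.

    Let b be a synchronizing word. Two points of X in which b occurs at the same
    place can be exchanged at that place: the past of the first followed by the
    future of the second is again in X ([splice_in]). For finite windows this is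
    the definition of a synchronizing word, and X is closed. Hence a block in
    which b occurs makes the past and the future independent, so that every point
    of X in which b occurs arbitrarily far to the right is in the set A^(+)
    ([Aright_of_occurs]), and every point in which b occurs arbitrarily far to
    the left is in A^(-) ([Aleft_of_occurs]).

    By transitivity some point of X contains two disjoint occurrences of b, say
    the word b w b. Repeated exchange gives (b w)^n b in the language of X for
    all n, so the periodic point z of period b w is in X ([repeat_window_in]).
    As b occurs in z arbitrarily far in both directions, the orbit p of z is
    neutral. A point of X that is right asymptotic to p ends in copies of b w and
    is therefore in A^(+) ([synchronizing_neutral_orbit]). So no orbit right
    asymptotic to p is contained in A^-, and F^-(p, p), which is nonempty by
    (H01), is empty. *)

Set Implicit Arguments.
Unset Strict Implicit.
Unset Printing Implicit Defensive.
Import Order.TTheory GRing.Theory Num.Theory.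
Local Open Scope classical_set_scope.
Local Open Scope ring_scope.

(** * Words, windows and shifts *)

Section Synchronization.
Variable Sigma : finType.
Implicit Types (X : set (config Sigma)) (x y z : config Sigma) (b w : seq Sigma).

Definition block x (k : int) (n : nat) : seq Sigma :=
  [seq x (k + m%:Z) | m <- iota 0 n].

Definition occurs b x (k : int) : Prop := block x k (size b) = b.

Lemma size_block x k n : size (block x k n) = n.
Proof. by rewrite size_map size_iota. Qed.

Lemma block_cat x k m n : block x k (m + n) = block x k m ++ block x (k + m%:Z) n.
Proof.
rewrite /block iotaD map_cat add0n; congr (_ ++ _).
rewrite -[in iota m n](addn0 m) iotaDl -map_comp; apply: eq_map => j /=.
by congr (x _); lia.
Qed.

Lemma eq_block x y k l n :
  (forall i : int, k <= i < k + n%:Z -> x i = y (i - k + l)) <->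
  block x k n = block y l n.
Proof.
split=> [xy|/eq_in_map xy i ki].
  apply/eq_in_map => m; rewrite mem_iota => mn.
  by rewrite xy; [congr (y _)|]; lia.
have := xy `|i - k|%N; rewrite mem_iota.
have -> : k + `|i - k|%N%:Z = i by lia.
by move=> ->; [congr (y _)|]; lia.
Qed.

Lemma block_shiftz x d k n : block (shiftz d x) k n = block x (k + d) n.
Proof. by apply: eq_map => m; rewrite /shiftz; congr (x _); lia. Qed.

Lemma eq_occurs b x y k : (forall i : int, k <= i < k + (size b)%:Z -> x i = y i) ->
  occurs b x k -> occurs b y k.
Proof.
rewrite /occurs => xy <-; rewrite size_block; apply/esym/eq_block => i ki.
by rewrite xy //; congr (y _); lia.
Qed.

Lemma occurs_period b z P (n m : int) :
  (forall j l : int, z (j + l * P%:Z) = z j) -> occurs b z n ->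
  occurs b z (n + m * P%:Z).
Proof.
move=> zP bn; rewrite /occurs -[RHS]bn; apply/eq_block => j jb.
by rewrite -(zP (j - _ + n) m); congr (z _); lia.
Qed.

Lemma shiftzD x m n : shiftz m (shiftz n x) = shiftz (m + n) x.
Proof. by apply/funext => i; rewrite /shiftz; congr (x _); lia. Qed.

Lemma shiftz0 x : shiftz 0 x = x.
Proof. by apply/funext => i; rewrite /shiftz addr0. Qed.

Lemma subshift_shiftz X x (n : int) : subshift X -> X x -> X (shiftz n x).
Proof.
move=> [_ SX]; move: x.
have Xnat (m : nat) x : X x -> X (shiftz m%:Z x).
  elim: m => [|m IH] Xx; first by rewrite shiftz0.
  by rewrite -SX; exists (shiftz m%:Z x); [exact: IH|rewrite shiftzD; congr shiftz; lia].
have Xneg (m : nat) x : X x -> X (shiftz (- m%:Z) x).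
  elim: m => [|m IH] Xx; first by rewrite oppr0 shiftz0.
  have := IH Xx; rewrite -[in X in X -> _]SX => -[y Xy yx].
  suff -> : shiftz (- m.+1%:Z) x = y by [].
  have -> : - m.+1%:Z = -1 - m%:Z :> int by lia.
  by rewrite -shiftzD -yx shiftzD addNr shiftz0.
by case: n => m x Xx; [exact: Xnat|rewrite NegzE; exact: Xneg].
Qed.

Lemma languageP X w : subshift X -> forall k,
  language X w -> exists2 x, X x & occurs w x k.
Proof.
move=> hX k [x [l [Xx wx]]]; exists (shiftz (l - k) x).
  exact: subshift_shiftz.
by rewrite /occurs block_shiftz [RHS]wx; congr block; lia.
Qed.

Lemma language_block X x k n : X x -> language X (block x k n).
Proof. by move=> Xx; exists x, k; rewrite size_block. Qed.

(** * Closedness and cylinder sets *)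

(** Convergence in the product topology is coordinatewise and the alphabet is
    discrete, so points that agree with z on growing windows converge to z. *)
Lemma closed_window X z : closed (X : set (fullshift Sigma)) ->
  (forall n : nat, exists2 y, X y & forall i : int, `|i| <= n%:Z -> y i = z i) ->
  X z.
Proof.
move=> clX near_z.
have /choice[y yP] : forall n : nat, exists y, X y /\
    forall i : int, `|i| <= n%:Z -> y i = z i.
  by move=> n; have [y ? ?] := near_z n; exists y.
apply: (@closed_cvg _ (fullshift Sigma) \oo _ y _ clX).
  by apply: nearW => n; case: (yP n).
apply/cvg_sup => i B [_ [[C _ <-]] /= Cz] CB.
exists `|i|%N => // n /= ni; apply: CB => /=.
by rewrite (proj2 (yP n)) //; lia.
Qed.

Lemma open_occurs w k : open ([set x | occurs w x k] : set (fullshift Sigma)).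
Proof.
elim: w k => [|a w IH] k.
  by rewrite (_ : [set x | _] = setT) ?predeqE //; exact: openT.
rewrite (_ : [set x | _] =
    (@mathcomp_extra.proj int (fun=> discrete_topology Sigma) k @^-1` [set a])
    `&` [set x | occurs w x (k + 1)]); last first.
  apply/seteqP; split=> x; rewrite /occurs /= -addn1 addnC block_cat /=.
    by rewrite addr0 => -[xk xw].
  by rewrite addr0 => -[<- ->].
apply: openI => //.
apply: open_comp => [x _|]; last exact: discrete_open.
exact: proj_continuous.
Qed.

(** * Exchange at a synchronizing word *)

Definition synchronizing_word X b : Prop :=
  forall a c : seq Sigma, language X (a ++ b) -> language X (b ++ c) ->
    language X (a ++ b ++ c).

Definition splice (k : int) x y : config Sigma :=
  fun i => if i < k then x i else y i.

(** Around k, a window of the spliced point reads a b c, where a b is a word of x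
    and b c is a word of y. Hence every window of it occurs in a point of X, and
    X is closed. *)
Lemma splice_in X b k x y : subshift X -> synchronizing_word X b ->
  X x -> X y -> occurs b x k -> occurs b y k -> X (splice k x y).
Proof.
move=> hX sync_b Xx Xy bx by_; apply: (closed_window (proj1 hX)) => n.
(* N is large enough for [k - N, k + N) to contain [-n, n]. *)
pose N := (n + `|k|)%N.+1.
have : language X (block x (k - N%:Z) N ++ b ++ block y (k + (size b)%:Z) N).
  apply: sync_b.
    rewrite -[X in _ ++ X]bx (_ : block x k _ = block x (k - N%:Z + N%:Z) (size b)).
      by rewrite -block_cat; exact: language_block.
    by congr block; lia.
  by rewrite -[X in X ++ _]by_ -block_cat; exact: language_block.
have -> : block x (k - N%:Z) N ++ b ++ block y (k + (size b)%:Z) N =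
          block (splice k x y) (k - N%:Z) (N + (size b + N)).
  rewrite block_cat; congr (_ ++ _).
    by apply/eq_block => i ki; rewrite /splice ifT; [congr (x _)|]; lia.
  rewrite -[X in X ++ _]by_ -block_cat; apply/eq_block => i ki.
  by rewrite /splice ifF; [congr (y _)|]; lia.
move=> /(languageP hX (k - N%:Z))[z Xz zw]; exists z => // i ni.
move: zw; rewrite /occurs size_block => /eq_block ->; last by lia.
by congr (splice k x y _); lia.
Qed.

(** The block of x that starts after i and reaches to the end of an occurrence of
    b decouples its past from its future. A continuation of this block contains
    the same occurrence, so it can be spliced to the whole past of x. *)
Lemma Aright_of_occurs X b x : subshift X -> synchronizing_word X b -> X x ->
  (forall i : int, exists2 k, i < k & occurs b x k) -> Aright X x.
Proof.
move=> hX sync_b Xx bx; split=> // i; have [k ik bk] := bx i.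
exists (`|k - i|%N + size b)%N; split; first by exists x.
move=> u [y Xy [yx yu]].
rewrite (_ : glue _ _ _ _ _ = splice k x y).
  apply: (splice_in hX sync_b) => //; apply: eq_occurs bk => j kj.
  by rewrite yx // in_itv /=; lia.
apply/funext => j; rewrite /glue /splice.
have [jk|kj] := ltP j k; first by case: ifP => // ?; rewrite ifT //; lia.
rewrite ifF; last by lia.
case: ifP => ji; first by rewrite yx // in_itv /=; lia.
by rewrite yu // in_itv /=; lia.
Qed.

Lemma Aleft_of_occurs X b x : subshift X -> synchronizing_word X b -> X x ->
  (forall i : int, exists2 k, k + (size b)%:Z <= i & occurs b x k) -> Aleft X x.
Proof.
move=> hX sync_b Xx bx; split=> // i; have [k ki bk] := bx i.
exists `|i - k|%N; split; first by exists x.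
move=> v [y Xy [yv yx]].
rewrite (_ : glue _ _ _ _ _ = splice k y x).
  apply: (splice_in hX sync_b) => //; apply: eq_occurs bk => j kj.
  by rewrite yx // in_itv /=; lia.
apply/funext => j; rewrite /glue /splice.
case: ifP => ji; first by rewrite ifT ?yv ?in_itv //=; lia.
by rewrite if_same ifF //; lia.
Qed.

(** * A neutral periodic orbit *)

(** Since transitivity yields a shift by n >= 0, possibly n = 0, the second
    cylinder is placed at size b + 1: the second occurrence then starts beyond
    the end of the first, even when b is empty. *)
Lemma recurrent_occurs X b : subshift X -> topologically_transitive X ->
  language X b ->
  exists x P, [/\ X x, (size b < P)%N, occurs b x 0 & occurs b x P%:Z].
Proof.
move=> hX trX Lb.
have meets k : [set x | occurs b x k] `&` X !=set0.
  by have [x Xx bx] := languageP hX k Lb; exists x.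
have [n [_ [[x [bx Xx] <-] bnx]]] :=
  trX _ _ (open_occurs b 0) (open_occurs b (size b).+1%:Z) (meets _) (meets _).
exists x, ((size b).+1 + n)%N; split => //; first by lia.
by move: bnx; rewrite /occurs /= block_shiftz.
Qed.

Definition repeat_window x (P : nat) : config Sigma := fun i => x (i %% P)%Z.

Lemma repeat_windowD x P i (m : int) :
  repeat_window x P (i + m * P%:Z) = repeat_window x P i.
Proof. by rewrite /repeat_window addrC modzMDl. Qed.

(** Write b w for the window of x on [0, P). Splicing a copy of x shifted by n P
    at the last b of a point that carries (b w)^n b produces a point that carries
    (b w)^(n+1) b. Shifting such a point to its middle makes it agree with the
    periodic point on a large window. *)
Lemma repeat_window_in X b x P : subshift X -> synchronizing_word X b -> X x ->
  (size b < P)%N -> occurs b x 0 -> occurs b x P%:Z ->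
  X (repeat_window x P) /\ occurs b (repeat_window x P) 0.
Proof.
move=> hX sync_b Xx bP b0 bPx; pose z := repeat_window x P.
have zx (i : int) : 0 <= i < P%:Z -> z i = x i.
  by move=> iP; rewrite /z /repeat_window modz_small //; lia.
have bz : occurs b z 0 by apply: eq_occurs b0 => i ib; rewrite zx //; lia.
have bzm (m : int) : occurs b z (m * P%:Z).
  by rewrite -[_ * _]add0r; apply: occurs_period bz => *; exact: repeat_windowD.
have zxP (i : int) : 0 <= i < P%:Z + (size b)%:Z -> z i = x i.
  move=> iP; have [|Pi] := ltP i P%:Z; first by move=> ?; rewrite zx //; lia.
  have : block z P%:Z (size b) = block x P%:Z (size b).
    by rewrite [RHS]bPx -[in LHS](mul1r P%:Z); exact: bzm.
  by move=> /eq_block -> //; [congr (x _)|]; lia.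
have grow (n : nat) : exists2 y, X y &
    forall i : int, 0 <= i < n%:Z * P%:Z + (size b)%:Z -> y i = z i.
  elim: n => [|n [y Xy yz]].
    by exists x => // i ib; rewrite zxP //; lia.
  exists (splice (n%:Z * P%:Z) y (shiftz (- (n%:Z * P%:Z)) x)).
    apply: (splice_in hX sync_b) => //; first exact: subshift_shiftz.
      by apply: eq_occurs (bzm n) => i ib; rewrite yz //; lia.
    by rewrite /occurs block_shiftz subrr.
  move=> i iP; rewrite /splice; case: ifP => ni; first by rewrite yz //; lia.
  rewrite /shiftz -zxP; last by lia.
  by rewrite -mulNr /z repeat_windowD.
split=> //; apply: (closed_window (proj1 hX)) => n.
have [y Xy yz] := grow (n.+1 + n.+1)%N.
exists (shiftz (n.+1%:Z * P%:Z) y); first exact: subshift_shiftz.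
by move=> i ni; rewrite /shiftz yz; [exact: repeat_windowD|nia].
Qed.

Lemma occurs_far_right b z P (n i : int) : (0 < P)%N ->
  (forall j m : int, z (j + m * P%:Z) = z j) -> occurs b z n ->
  exists2 k, i < k & occurs b z k.
Proof.
move=> P0 zP bn; exists (n + (`|i| + `|n| + 1) * P%:Z); first by nia.
exact: occurs_period.
Qed.

Lemma occurs_far_left b z P (n i : int) : (0 < P)%N ->
  (forall j m : int, z (j + m * P%:Z) = z j) -> occurs b z n ->
  exists2 k, k + (size b)%:Z <= i & occurs b z k.
Proof.
move=> P0 zP bn; exists (n + - (`|i| + `|n| + (size b)%:Z) * P%:Z); first by nia.
exact: occurs_period.
Qed.

(** The periodic orbit is neutral because b occurs in its points arbitrarily far
    in both directions; the occurrences to the right are inherited by every point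
    that is right asymptotic to it. *)
Lemma synchronizing_neutral_orbit X : subshift X -> synchronizing X ->
  exists2 p, neutral X p & Fright X p `<=` [set x | exists2 a, x a & Aright X a].
Proof.
move=> hX [trX [b Lb sync_b]].
have [x [P [Xx bP b0 bPx]]] := recurrent_occurs hX trX Lb.
have [Xz bz] := repeat_window_in hX sync_b Xx bP b0 bPx.
set z := repeat_window x P in Xz bz.
have P0 : (0 < P)%N by lia.
have orbit_z q : Defs.orbit z q -> [/\ X q, exists k, occurs b q k &
    forall j m : int, q (j + m * P%:Z) = q j].
  move=> [n ->]; split; first exact: subshift_shiftz.
    by exists (- n); rewrite /occurs block_shiftz addNr.
  by move=> j m; rewrite /shiftz addrAC; exact: repeat_windowD.
exists (Defs.orbit z).
  split; first by exists z.
  exists z; split=> //.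
    exists P => //; apply/funext => i.
    by rewrite /shiftz -[in LHS](mul1r P%:Z); exact: repeat_windowD.
  move=> q /orbit_z[Xq [k bq] qP]; split.
    by apply: (Aleft_of_occurs hX sync_b) => // i; exact: (occurs_far_left i P0 qP bq).
  by apply: (Aright_of_occurs hX sync_b) => // i; exact: (occurs_far_right i P0 qP bq).
move=> y [[w Xw wy] _ [a [q [ya /orbit_z[Xq [k bq] qP] [N aq]]]]].
exists a => //; apply: (Aright_of_occurs hX sync_b).
  by move: ya; rewrite -wy => -[n ->]; exact: subshift_shiftz.
move=> i; have [l il bl] := occurs_far_right (`|i| + `|N|) P0 qP bq.
by exists l; [lia|apply: eq_occurs bl => j jl; rewrite aq //; lia].
Qed.

End Synchronization.

Theorem theorem3p1 (Sigma : finType) (X : set (config Sigma)) (M : nat)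
  (mu : exponents Sigma)
  (hX : subshift X)
  (h01 : H01 X) (h02 : H02 X) (h03 : H03 X M)
  (hmu : forall x y : orbit_t Sigma, (M <= mu x y)%N)
  (h04 : H04 X) (h05 : H05 X) (h06 : H06 X) (h07 : H07 X mu)
  (h08 : H08 X mu) (h09 : H09 X mu) (h10 : H10 X mu) (h11 : H11 X mu) :
  ~ synchronizing X.
Proof.
move=> /(synchronizing_neutral_orbit hX)[p p_neutral p_right].
have [[y [[_ yp] yminus]] _] := h01 p p p_neutral p_neutral.
have [a ya a_right] := p_right _ yp.
by have [a_left] := yminus _ ya; apply.
Qed.
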